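(* Let $g\colon\mathbb{N}\to\mathbb{N}$ be any non-decreasing unbounded function. Then $\mu$ is a shell numbering for $\phi_g$; that is, for all $(x_1,y_1),(x_2,y_2)\in\mathbb{N}^2$, $\mu(x_1,y_1)<\mu(x_2,y_2)$ implies $\phi_g(x_1,y_1)<\phi_g(x_2,y_2)$.
   Context: $\mathbb{N}$ denotes the non-negative integers. $g$ is non-decreasing if $x\le y$ implies $g(x)\le g(y)$, and unbounded if for every $y$ there is $x$ with $g(x)\ge y$. Define $g^+(y)$ to be the smallest $x\in\mathbb{N}$ with $g(x)\ge y$. The step points of $g$ are the elements of the range of $g^+$, listed as $s_0<s_1<s_2<\cdots$. For $k\in\mathbb{N}$ let $B_k=\{0,1,\ldots,s_{k+1}(g(s_k)+1)-1\}$. Define $\phi_g(x,y)=y\cdot g^+(y)+x$ if $y>g(x)$, and $\phi_g(x,y)=x(g(x)+1)+y$ otherwise. For $(x,y)\in\mathbb{N}^2$, $\mu(x,y)$ is the smallest non-negative integer $k$ such that $\phi_g(x,y)\in B_k$. *)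

(* Defs.v *)
From mathcomp Require Import all_boot.
From mathcomp Require Import boolp.

Set Implicit Arguments.
Unset Strict Implicit.
Unset Printing Implicit Defensive.

Definition nondecreasing (g : nat -> nat) : Prop :=
  forall x y, x <= y -> g x <= g y.

Definition unbounded (g : nat -> nat) : Prop :=
  forall y, exists x, y <= g x.

(* [gplus gu] is g^+; the proof [gu] only serves to make the minimum total. *)
Definition gplus (g : nat -> nat) (gu : unbounded g) (y : nat) : nat :=
  ex_minn (gu y).

Definition step_point (g : nat -> nat) (gu : unbounded g) (x : nat) : bool :=
  `[< exists y, gplus gu y = x >].

Lemma step_points_infinite (g : nat -> nat) (gu : unbounded g) (n : nat) :
  exists x, (n <= x) && step_point gu x.
Proof.
pose y := (\max_(i < n) g i).+1.
exists (gplus gu y); apply/andP; split; last by apply/asboolP; exists y.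
rewrite /gplus; case: ex_minnP => m ym _; rewrite leqNgt; apply/negP => mn.
by move: ym; rewrite /y ltnNge (leq_bigmax (Ordinal mn)).
Qed.

Definition next_step (g : nat -> nat) (gu : unbounded g) (n : nat) : nat :=
  ex_minn (step_points_infinite gu n).

(* The increasing enumeration s_0 < s_1 < ... of the range of g^+: s_0 is the
   least step point and s_(k+1) the least step point greater than s_k. *)
Fixpoint s (g : nat -> nat) (gu : unbounded g) (k : nat) : nat :=
  if k is k'.+1 then next_step gu (s gu k').+1 else next_step gu 0.

Lemma s_lt (g : nat -> nat) (gu : unbounded g) (k : nat) : s gu k < s gu k.+1.
Proof. by rewrite [s gu k.+1]/= /next_step; case: ex_minnP => m /andP[]. Qed.

Lemma leq_s (g : nat -> nat) (gu : unbounded g) (k : nat) : k <= s gu k.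
Proof. by elim: k => // k IH; apply: leq_ltn_trans IH (s_lt gu k). Qed.

Lemma s_range (g : nat -> nat) (gu : unbounded g) (x : nat) :
  (exists k, s gu k = x) <-> (exists y, gplus gu y = x).
Proof.
split=> [[k <-]|xs].
  by case: k => [|k] /=; rewrite /next_step; case: ex_minnP => m /andP[_ /asboolP].
have {}xs : step_point gu x by apply/asboolP.
have exk : exists k, x <= s gu k by exists x; apply: leq_s.
case: (ex_minnP exk) => k xk kmin; exists k; apply/eqP; rewrite eqn_leq xk andbT.
case: k xk kmin => [|k] _ kmin /=; rewrite /next_step; case: ex_minnP => m _.
  by apply; rewrite xs.
by apply; rewrite xs andbT ltnNge; apply/negP => /kmin; rewrite ltnn.
Qed.

Definition B (g : nat -> nat) (gu : unbounded g) (k : nat) : {pred nat} :=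
  [pred n | n < s gu k.+1 * (g (s gu k) + 1)].

Definition phi (g : nat -> nat) (gu : unbounded g) (x y : nat) : nat :=
  if y > g x then y * gplus gu y + x else x * (g x + 1) + y.

Lemma B_cover (g : nat -> nat) (gu : unbounded g) (n : nat) :
  exists k, n \in B gu k.
Proof.
exists n; rewrite inE addn1.
exact: leq_trans (leq_s gu n.+1) (leq_pmulr _ _).
Qed.

Definition mu (g : nat -> nat) (gu : unbounded g) (x y : nat) : nat :=
  ex_minn (B_cover gu (phi gu x y)).

Definition shell_numbering (sigma f : nat -> nat -> nat) : Prop :=
  forall x1 y1 x2 y2, sigma x1 y1 < sigma x2 y2 -> f x1 y1 < f x2 y2.

(* Main.v *)
Require Import Defs.
From mathcomp Require Import all_boot.

(* Each [B k] is an initial segment of the naturals: if [k1] is smaller than the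
   least [k] with [phi x2 y2 \in B k], then [phi x2 y2] lies above all of
   [B k1], in particular above [phi x1 y1]. *)

Theorem theorem4p9 (g : nat -> nat) (gm : nondecreasing g) (gu : unbounded g) :
  shell_numbering (mu gu) (phi gu).
Proof.
move=> x1 y1 x2 y2; rewrite /mu.
(* The two minima enter differently: [k1] through membership of the first value in [B gu k1], [k2]
   through its minimality for the second. *)
case: ex_minnP => k1 in1 _; case: ex_minnP => k2 _ min2 lt12.
(* Otherwise minimality would give [k2 <= k1], against [lt12]. *)
have notin2 : phi gu x2 y2 \notin B gu k1.
  by apply/negP => /min2; rewrite leqNgt lt12.
(* The bound defining [B gu k1] separates the two values: the first is strictly below it, the second
   at or above it. *)
by move: in1 notin2; rewrite !inE -leqNgt; apply: leq_trans.
Qed.
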